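(* Let $D\subset\mathbf{R}^n$, let $f:D\to\mathbf{R}$ be a function, let $P_0\in\mathbf{R}^n$ be an accumulation point of $D$, and let $L$ be a real constant. Let $(x^1,x^2,\ldots,x^n)$ be a set of coordinates representing points of $\mathbf{R}^n$, and let $\{x^{i_1},x^{i_2},\ldots,x^{i_{n'}}\}$ be a subset of these coordinates all of whose elements are bounded in a punctured neighborhood of $P_0$. Then $\lim_{P\to P_0,\,P\in D} f(P)=L$ if and only if the following condition holds: for every sequence of points $\{P_m\}\subset D$, with $P_m$ having coordinates $(x_m^1,x_m^2,\ldots,x_m^n)$, such that $\lim_{m\to\infty}P_m=P_0$ and each of the real sequences $\{x_m^{i_1}\}_m,\{x_m^{i_2}\}_m,\ldots,\{x_m^{i_{n'}}\}_m$ converges, one has $\lim_{m\to\infty} f(P_m)=L$.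
   Context: A punctured neighborhood of $P_0$ is a set $\{P\in\mathbf{R}^n:0<|P-P_0|<r\}$ with $r>0$. A set of coordinates means that points are represented by tuples $(x^1,\ldots,x^n)$ of real numbers; for example, hyperspherical coordinates $(r,\phi_1,\ldots,\phi_{n-1})$ centered at $P_0$, for which any non-empty subset of $\{r,\phi_1,\ldots,\phi_{n-1}\}$ satisfies the boundedness requirement. The limit $\lim_{P\to P_0,\,P\in D} f(P)=L$ means: $P_0$ is an accumulation point of $D$ and for every $\varepsilon>0$ there is a punctured neighborhood $U_0$ of $P_0$ such that $|f(P)-L|<\varepsilon$ for all $P\in U_0\cap D$. Convergence $P_m\to P_0$ is in the Euclidean sense.
   Formalization: The sequences {P_m} are required to lie in D and to avoid P_0; without this the claim fails when P_0 is in D and f(P_0) ≠ L (for example D = R, f the indicator of {0}, P_0 = 0, L = 0). *)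

(* Defs.v *)
From HB Require Import structures.
From mathcomp Require Export all_boot all_order all_algebra.
From mathcomp Require Export all_classical all_reals all_analysis.
Export numFieldNormedType.Exports.

Set Implicit Arguments.
Unset Strict Implicit.
Unset Printing Implicit Defensive.

Import Order.TTheory GRing.Theory Num.Theory.

Local Open Scope classical_set_scope.
Local Open Scope ring_scope.

(* The library norm on 'rV[R]_n is the max norm, hence this definition. *)
Definition eucl_dist (R : realType) (n : nat) (P Q : 'rV[R]_n) : R :=
  Num.sqrt (\sum_(i < n) (P 0 i - Q 0 i) ^+ 2).

Definition punctured_nbhd (R : realType) (n : nat) (P0 : 'rV[R]_n) (r : R) :
    set 'rV[R]_n :=
  [set P | 0 < eucl_dist P P0 < r].

Definition accumulation_point (R : realType) (n : nat)
    (D : set 'rV[R]_n) (P0 : 'rV[R]_n) : Prop :=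
  forall r : R, 0 < r -> punctured_nbhd P0 r `&` D !=set0.

(* A function D -> R is modelled by a total function whose values outside D
   are irrelevant. *)
Definition limit_along (R : realType) (n : nat) (D : set 'rV[R]_n)
    (f : 'rV[R]_n -> R) (P0 : 'rV[R]_n) (L : R) : Prop :=
  accumulation_point D P0 /\
  forall e : R, 0 < e -> exists2 r : R, 0 < r &
    forall P, (punctured_nbhd P0 r `&` D) P -> `|f P - L| < e.

Definition converges_to (R : realType) (n : nat)
    (P : nat -> 'rV[R]_n) (P0 : 'rV[R]_n) : Prop :=
  eucl_dist (P m) P0 @[m --> \oo] --> (0 : R).

(* Each admissible tuple represents one point and each point is represented by
   at least one admissible tuple. Uniqueness of the tuple is not required: the
   hyperspherical angles of a point on a polar axis are not determined. *)
Record coordinates (R : realType) (n : nat) := Coordinates {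
  coord_dom : set 'rV[R]_n;
  coord_point : 'rV[R]_n -> 'rV[R]_n;
  coord_surj : forall P, exists2 x, coord_dom x & coord_point x = P
}.

Definition has_coords (R : realType) (n : nat) (C : coordinates R n)
    (P x : 'rV[R]_n) : Prop :=
  coord_dom C x /\ coord_point C x = P.

(* I is the set of indices of the selected coordinates. *)
Definition coords_bounded_near (R : realType) (n : nat) (C : coordinates R n)
    (I : {set 'I_n}) (P0 : 'rV[R]_n) : Prop :=
  exists2 r : R, 0 < r &
    forall i, i \in I -> exists M : R, forall P x : 'rV[R]_n,
      punctured_nbhd P0 r P -> has_coords C P x -> `|x 0 i| <= M.

(* Main.v *)
(* If the limit fails, some sequence of D converges to P0 while f stays at
   distance at least e from L. Its selected coordinates are bounded, so finitely
   many applications of Bolzano-Weierstrass give a subsequence along which all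
   of them converge, and there the sequential condition is violated. *)
Require Import Defs.
Import Order.TTheory GRing.Theory Num.Theory.
Local Open Scope classical_set_scope.
Local Open Scope ring_scope.

(** Turns the lower bound in [punctured_nbhd] into [P != P0] and back. *)
Lemma eucl_dist_gt0 (R : realType) (n : nat) (P Q : 'rV[R]_n) :
  (0 < eucl_dist P Q) = (P != Q).
Proof.
rewrite /eucl_dist sqrtr_gt0 lt_neqAle sumr_ge0 ?andbT; last first.
  by move=> i _; exact: sqr_ge0.
rewrite eq_sym psumr_eq0; last by move=> i _; exact: sqr_ge0.
congr (~~ _); apply/allP/eqP => [PQ|-> i _ /=]; last by rewrite subrr expr0n.
apply/rowP => i; apply/eqP; rewrite -subr_eq0 -sqrf_eq0.
by apply: PQ; rewrite mem_index_enum.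
Qed.

(** A strictly increasing [phi] on the naturals satisfies [m <= phi m], so it maps each tail
    [N <= m] into itself. *)
Lemma cvgn_comp_increasing (T : topologicalType) (u : nat -> T) (l : T)
    (phi : nat -> nat) :
  increasing_seq phi -> u m @[m --> \oo] --> l ->
  u (phi m) @[m --> \oo] --> l.
Proof.
move=> phi_incr; apply: cvg_comp => A [N _ NA]; exists N => //= m Nm.
apply: NA => /=; apply: leq_trans Nm _.
elim: m => // m IHm; apply: leq_ltn_trans IHm _.
by rewrite ltnNge [(_ <= _)%N](phi_incr m.+1 m) -ltnNge.
Qed.

(** Induction on [s]: the subsequence [phi] found for the tail is refined by a Bolzano-Weierstrass
    subsequence [psi] for the head, and refining keeps the limits already secured. *)
Lemma bolzano_weierstrass_family (R : realType) (I : eqType) (s : seq I)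
    (u : I -> nat -> R) :
  (forall i, i \in s -> bounded_fun (u i)) ->
  exists2 phi : nat -> nat, increasing_seq phi &
    forall i, i \in s -> cvgn (u i \o phi).
Proof.
elim: s => [_|i s IHs u_bnd]; first by exists id.
have [|phi phi_incr phi_cvg] := IHs.
  by move=> j js; apply: u_bnd; rewrite inE js orbT.
have [|psi psi_incr psi_cvg] := @bolzano_weierstrass R (u i \o phi).
  have [M [Mreal uM]] := u_bnd i (mem_head i s).
  by exists M; split=> // N /uM uN m _; exact: uN.
exists (phi \o psi) => [m k /=|j]; first by rewrite phi_incr; exact: psi_incr.
rewrite inE => /predU1P[->//|/phi_cvg /cvg_ex[l phil]].
by apply/cvg_ex; exists l; exact: (@cvgn_comp_increasing _ (u j \o phi)).
Qed.

Theorem theorem3 (R : realType) (n : nat) (D : set 'rV[R]_n)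
    (f : 'rV[R]_n -> R) (P0 : 'rV[R]_n) (L : R)
    (C : coordinates R n) (I : {set 'I_n})
    (hP0 : accumulation_point D P0)
    (hI : coords_bounded_near C I P0) :
  limit_along D f P0 L <->
  (forall P x : nat -> 'rV[R]_n,
     (forall m, D (P m) /\ P m <> P0) ->
     (forall m, has_coords C (P m) (x m)) ->
     converges_to P P0 ->
     (forall i, i \in I -> cvgn (fun m => x m 0 i)) ->
     f (P m) @[m --> \oo] --> L).
Proof.
split=> [[_ limf] P x DP _ PP0 _|seqlim].
  apply/cvgrPdistC_lt => e /limf[r r0 fr].
  move/cvgr0Pnorm_lt: PP0 => /(_ _ r0); apply: filterS => m Pmr.
  (* [limit_along] says nothing about [f P0]; [P m <> P0] is what places the term in the punctured
     neighborhood. *)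
  have [DPm /eqP PmP0] := DP m.
  apply: fr; split => //; rewrite /punctured_nbhd /= eucl_dist_gt0 PmP0 /=.
  exact: le_lt_trans (ler_norm _) Pmr.
split=> // e e0; apply: contrapT => /forall2NP nolim.
have [r0 r0_gt0 bnd] := hI.
(* In the radius, [r0] keeps the coordinate bounds available and [m.+1%:R^-1] forces convergence to
   [P0]. The tuple is chosen along with the point, which may have several. *)
have step (m : nat) : exists Px : 'rV[R]_n * 'rV[R]_n,
    [/\ punctured_nbhd P0 (Num.min r0 m.+1%:R^-1) Px.1, D Px.1,
        has_coords C Px.1 Px.2 & e <= `|f Px.1 - L|].
  have [|] := nolim (Num.min r0 m.+1%:R^-1).
    by rewrite lt_min r0_gt0 invr_gt0 ltr0Sn.
  move=> /existsNP[P /not_implyP[[PP0 DP] /negP]]; rewrite -leNgt => fP.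
  by have [x Cx xP] := coord_surj C P; exists (P, x).
have {step}[Px PxP] := choice step.
have [i|phi phi_incr phi_cvg] :=
    @bolzano_weierstrass_family R _ (enum I) (fun i m => (Px m).2 0 i).
  (* [bounded_fun] asks every [N > M] to be a bound; [xM] applies because the radii are at most
     [r0]. *)
  rewrite mem_enum => /bnd[M xM]; exists M; split; first exact: num_real.
  move=> N /ltW MN m _; have [/andP[Pm0 Pmr] _ Pxm _] := PxP m.
  apply: le_trans MN; apply: xM Pxm; rewrite /punctured_nbhd /= Pm0.
  by move: Pmr; rewrite lt_min => /andP[].
have phi_lim : f (Px (phi m)).1 @[m --> \oo] --> L.
  apply: (seqlim _ (fun m => (Px (phi m)).2)) => [m|m||i Ii].
  - have [/andP[+ _] DP _ _] := PxP (phi m).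
    by rewrite eucl_dist_gt0 => /eqP.
  - by have [] := PxP (phi m).
  (* The distances of the full sequence are squeezed between 0 and the harmonic sequence; the
     subsequence inherits the limit. *)
  - apply: (@cvgn_comp_increasing _ (fun m => eucl_dist (Px m).1 P0)) => //.
    apply: (squeeze_cvgr _ (cvg_cst 0) cvg_harmonic).
    apply: nearW => m /=; have [/andP[/ltW -> +] _ _ _] := PxP m.
    by rewrite lt_min => /andP[_ /ltW].
  - by apply: phi_cvg; rewrite mem_enum.
move/cvgrPdistC_lt: phi_lim => /(_ _ e0) /filter_ex[m].
by have [_ _ _ /le_gtF ->] := PxP (phi m).
Qed.
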